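(* Let $0<\alpha,\beta<1$, let $m,n$ be arbitrary (nonzero) parameters, and consider the variable coefficient nonlinear space-time fractional Burgers' equation $$u_t^{(\alpha)} = f(t)\,u_x^{(2\beta)} + g(t)\,\bigl(u_x^{(\beta)}\bigr)^2,\qquad x\in(0,\infty),\ t>0.$$ Let $G(t)$ be a function with $G_t^{(\alpha)}(t)=g(t)$. Under the transformations $$\varsigma(x,t)=\frac{t^\alpha}{\Gamma(1+\alpha)},\qquad \varphi(\varsigma)=\frac{x^\beta}{\Gamma(1+\beta)}-\frac{n}{m}\,u,$$ the fractional Burgers' equation reduces to the ordinary fractional differential equation $$\varphi_t^{(\alpha)}+\frac{m}{n}\,G_t^{(\alpha)}=0,$$ which has the general solution $$u(x,t)=\frac{m}{n}\left[\frac{x^\beta}{\Gamma(1+\beta)}+\frac{m}{n}\,G(t)-k_4\right],$$ with $k_4$ an arbitrary constant.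
   Context: Fractional derivatives are Jumarie's modified Riemann-Liouville derivatives: for $0<\alpha<1$, $$D_x^\alpha h(x)=\frac{1}{\Gamma(1-\alpha)}\frac{d}{dx}\int_0^x (x-s)^{-\alpha}\bigl(h(s)-h(0)\bigr)\,ds.$$ Notation: $u_t^{(\alpha)}=D_t^\alpha u$, $u_x^{(\beta)}=D_x^\beta u$, $u_x^{(2\beta)}=D_x^\beta D_x^\beta u$; similarly $G_t^{(\alpha)}=D_t^\alpha G$, and $\varphi_t^{(\alpha)}=D_t^\alpha\varphi$ with $\varphi$ regarded as a function of $t$ through $\varsigma$. The coefficients $f,g$ are given functions of $t$. The paper adopts the following calculus rules for this derivative and uses them throughout: the product rule $D_x^\alpha(uv)=(D_x^\alpha u)v+u(D_x^\alpha v)$; the chain rule $D_t^\alpha h(x(t))=\frac{dh}{dx}\,D_t^\alpha x(t)$ for $0<\alpha<1$ provided $\frac{dh}{dx}$ exists; and the power rule $D_x^\alpha x^\beta=\frac{\Gamma(1+\beta)}{\Gamma(1+\beta-\alpha)}x^{\beta-\alpha}$. ''Reduces to'' means that substituting the given form of $u$ into the Burgers' equation, using these rules, yields the stated equation for the function of the similarity variable; the general solution is expressed in terms of $u$ via the stated transformation.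
   Formalization: That every solution has the stated form is proved for G and φ continuous on [0,∞); without continuity it fails, e.g. g=G=0 and φ(ς(t))=t^(α−1) for t>0, φ(0)=0, has zero fractional derivative but is not constant. *)

(* Defs.v *)
From HB Require Import structures.
From mathcomp Require Import all_boot all_order all_algebra.
From mathcomp Require Import all_classical all_reals all_analysis.
Set Implicit Arguments.
Unset Strict Implicit.
Unset Printing Implicit Defensive.
Import Order.TTheory GRing.Theory Num.Theory.
Import numFieldNormedType.Exports.
Local Open Scope classical_set_scope.
Local Open Scope ring_scope.

(* Euler's integral; only used at arguments z > 0, where it converges. *)
Definition Gamma {R : realType} (z : R) : R :=
  \int[@lebesgue_measure R]_(s in `]0, +oo[) (s `^ (z - 1) * expR (- s)).

Section Jumarie.
Context {R : realType}.
Implicit Types (a x : R) (h : R -> R).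

(* The integrand takes the value 0 at s = x when a != 0, since 0 `^ (- a) = 0;
   this has no effect on the integral. *)
Definition jumarie_integrand a h x (s : R) : R :=
  (x - s) `^ (- a) * (h s - h 0).

Definition jumarie_integral a h x : R :=
  \int[@lebesgue_measure R]_(s in `[0, x]) jumarie_integrand a h x s.

Definition slope (F : R -> R) x (y : R) : R := (F y - F x) / (y - x).

(* Punctured neighbourhoods of x in the half-line [0, +oo[: the derivative is
   the usual two-sided one at x > 0, and the right derivative at x = 0.  The
   latter is needed for the iterated operator, since D^a (D^a h) involves the
   value of D^a h at the origin. *)
Definition dnbhs_half x : set_system R := within `[0, +oo[ (dnbhs x).

(* Meaningful only when [jumarie_derivable a h x] holds. *)
Definition jumarie a h x : R :=
  (Gamma (1 - a))^-1 *
  lim (slope (jumarie_integral a h) x y @[y --> dnbhs_half x]).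

Definition jumarie_derivable a h x : Prop :=
  (forall y, 0 <= y ->
     (@lebesgue_measure R).-integrable `[0, y]
       (EFin \o jumarie_integrand a h y)) /\
  cvg (slope (jumarie_integral a h) x y @[y --> dnbhs_half x]).

End Jumarie.

Section Burgers.
Context {R : realType}.
Implicit Types (a b m n t x : R) (f g G phi : R -> R) (u : R -> R -> R).

(* u_t^(a) = f(t) u_x^(2b) + g(t) (u_x^(b))^2, with u written as u x t. *)
Definition burgers_solution a b f g u : Prop :=
  forall x t, 0 < x -> 0 < t ->
    [/\ jumarie_derivable a (u x) t,
        (forall y, 0 <= y -> jumarie_derivable b (u ^~ t) y),
        jumarie_derivable b (jumarie b (u ^~ t)) x
      & jumarie a (u x) t =
          f t * jumarie b (jumarie b (u ^~ t)) x
          + g t * jumarie b (u ^~ t) x ^+ 2].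

Definition similarity_var a t : R := t `^ a / Gamma (1 + a).

(* The boundary x = 0, t = 0 is included because the fractional derivatives
   at x > 0 and t > 0 involve the values of u there. *)
Definition similarity_form a b m n u phi : Prop :=
  forall x t, 0 <= x -> 0 <= t ->
    phi (similarity_var a t) = x `^ b / Gamma (1 + b) - n / m * u x t.

Definition reduced_solution a m n G phi : Prop :=
  forall t, 0 < t ->
    jumarie_derivable a (phi \o similarity_var a) t /\
    jumarie a (phi \o similarity_var a) t + m / n * jumarie a G t = 0.

Definition general_solution b m n G (k4 : R) : R -> R -> R :=
  fun x t => m / n * (x `^ b / Gamma (1 + b) + m / n * G t - k4).

End Burgers.

(* Main.v *)
Require Import Defs.
From mathcomp Require Import all_boot all_order all_algebra.
From mathcomp Require Import all_classical all_reals all_analysis.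
From mathcomp Require Import measurable_realfun ring.
Import Order.TTheory GRing.Theory Num.Theory.
Import numFieldNormedType.Exports.
Local Open Scope classical_set_scope.
Local Open Scope ring_scope.
Set Implicit Arguments.
Unset Strict Implicit.
Unset Printing Implicit Defensive.

(** Write [sv] for [similarity_var a] and solve the similarity form for [u]:
    [u x t = m/n * (x^b / Gamma (1 + b) - phi (sv t))].  In [x] this is an
    affine function of [x^b], and the power rule
    [D^b x^b = Gamma (1 + b)] (lemma [jumarie_powR]) makes [D_x^b u] the
    constant [m/n]; its own fractional derivative is then zero, and the
    diffusion term disappears.  In [t], linearity and the
    vanishing of [D^a] on constants give [D_t^a u = - (m/n) D_t^a phi].  So
    Burgers' equation reads [- (m/n) D_t^a phi = g (m/n)^2], which is the
    reduced equation since [g = D_t^a G] (lemma [burgers_reduction]).  The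
    announced solution is the case [phi (sv t) = k4 - m/n * G t].

    For the converse, [H = phi \o sv + m/n * G] satisfies [D^a H = 0] on
    [t > 0], and one has to see that a continuous such [H] is constant
    (lemma [jumarie_eq0_cst]).  The integral [J] of [H - H 0] against the
    kernel [(x - s)^(-a)] has derivative zero, hence is constant for [t > 0], and it
    tends to [0] at the origin because its kernel is integrable; so [J = 0].
    Abel's trick recovers [H]: integrating [J] once more, to the order [a],
    gives a nonzero multiple of the ordinary primitive of [H - H 0].

    Both halves rest on one computation.  With the kernels
    [kern p x = x^(p-1)] on [x > 0] and the convolution product of nonnegative
    extended-real functions, [kern p * kern q = B(p, q) kern (p + q)] by
    homogeneity (lemma [convol_kern]).  Multiplying the kernels by [exp (- x)]
    and integrating over the line turns this into Euler's
    [Gamma p Gamma q = B(p, q) Gamma (p + q)] (lemma [egamma_beta]), which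
    evaluates the constant of the power rule.  Associativity of the
    convolution (lemma [convolA]) gives Abel's inversion.  Working with
    nonnegative functions lets Tonelli's theorem replace most integrability
    discussions; signed functions are treated through their positive and
    negative parts. *)

(** * Convolution of nonnegative functions on the line *)

Section lebesgue_affine.
Context {R : realType}.
Local Notation mu := (@lebesgue_measure R).
Local Open Scope ereal_scope.

(** By uniqueness of Lebesgue measure: its image by a translation gives the
    same length to intervals. *)
Lemma ge0_integral_shift (f : R -> \bar R) (c : R) :
  measurable_fun [set: R] f -> (forall x, 0 <= f x) ->
  \int[mu]_x f (x + c)%R = \int[mu]_x f x.
Proof.
move=> mf f0.
pose phi : R -> measurableTypeR R := fun x => (x + c)%R.
have mphi : measurable_fun [set: R] phi by exact: measurable_funD.
have -> : \int[mu]_x f x = \int[pushforward mu phi]_x f x.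
  apply: eq_measure_integral => A mA _.
  apply: lebesgue_measure_unique => // _ [[a b]] _ <-.
  rewrite [RHS](_ : _ = mu `](a - c)%R, (b - c)%R]%classic); last first.
    congr (mu _).
    by apply/seteqP; split => x /=; rewrite /phi !in_itv/= ltrBlDr lerBrDr.
  rewrite !lebesgue_measure_itv/= !lte_fin ltrD2r.
  by case: ifPn => // _; rewrite -!EFinB; congr EFin; rewrite opprB addrA subrK.
by rewrite ge0_integral_pushforward.
Qed.

Lemma ge0_integral_scale (f : R -> \bar R) (c : R) : (0 < c)%R ->
  measurable_fun [set: R] f -> (forall x, 0 <= f x) ->
  \int[mu]_x f x = c%:E * \int[mu]_x f (c * x)%R.
Proof.
move=> c0 mf f0.
pose phi : R -> measurableTypeR R := fun x => (c * x)%R.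
have mphi : measurable_fun [set: R] phi by exact: measurable_funM.
have cN : (0 <= c)%R by exact: ltW.
pose m := mscale (NngNum cN) mu.
have -> : \int[mu]_x f x = \int[pushforward m phi]_x f x.
  apply: eq_measure_integral => A mA _.
  apply: lebesgue_measure_unique => // _ [[a b]] _ <-.
  rewrite [RHS](_ : _ = c%:E * mu `](a / c)%R, (b / c)%R]%classic); last first.
    congr (_ * mu _).
    apply/seteqP; split => x /=; rewrite /phi !in_itv/= ltr_pdivrMr//;
      by rewrite ler_pdivlMr// (mulrC c).
  rewrite !lebesgue_measure_itv/= !lte_fin ltr_pM2r ?invr_gt0//.
  case: ifPn => // _; rewrite ?mule0// -!EFinB -EFinM -mulrBl.
  by congr EFin; rewrite mulrC divfK// gt_eqF.
rewrite ge0_integral_pushforward// preimage_setT ge0_integral_mscale//.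
- exact: measurableT_comp.
- by move=> x _; exact: f0.
Qed.

Lemma ge0_integral_reflect (f : R -> \bar R) (c : R) :
  measurable_fun [set: R] f -> (forall x, 0 <= f x) ->
  \int[mu]_x f (c - x)%R = \int[mu]_x f x.
Proof.
move=> mf f0.
pose phi : R -> measurableTypeR R := fun x => (- x)%R.
have mphi : measurable_fun [set: R] phi by exact: measurable_funN.
rewrite -(ge0_integral_shift (f := fun x => f (c - x)%R) c)//; last first.
  by apply: measurableT_comp => //; exact: measurable_funB.
have -> : \int[mu]_x f x = \int[pushforward mu phi]_x f x.
  by apply: eq_measure_integral => A mA _; exact/esym/lebesgue_measureN.
rewrite ge0_integral_pushforward//.
by apply: eq_integral => x _; rewrite opprD addrA addrAC subrr add0r.
Qed.

End lebesgue_affine.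

Section convolution.
Context {R : realType}.
Local Notation mu := (@lebesgue_measure R).
Local Open Scope ereal_scope.
Implicit Types f g h : R -> \bar R.

Definition convol f g (x : R) : \bar R := \int[mu]_s (f (x - s)%R * g s).

Definition nnmeas f := measurable_fun [set: R] f /\ forall x, 0 <= f x.

Let mshift f : measurable_fun [set: R] f ->
  measurable_fun [set: R * R] (fun z : R * R => f (z.1 - z.2)%R).
Proof. by move=> mf; apply: measurableT_comp => //; exact: measurable_funB. Qed.

Lemma nnmeas_convol f g : nnmeas f -> nnmeas g -> nnmeas (convol f g).
Proof.
move=> [mf f0] [mg g0]; split; last first.
  by move=> x; apply: integral_ge0 => s _; rewrite mule_ge0.
pose F (z : measurableTypeR R * measurableTypeR R) := f (z.1 - z.2)%R * g z.2.
apply: (measurable_fun_fubini_tonelli_F (m2 := mu) F).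
- apply: emeasurable_funM; first exact: mshift.
  exact: measurableT_comp.
- by move=> z; rewrite mule_ge0.
Qed.

(** Tonelli's theorem puts the variable of [h] outside; the inner integral is
    then a translate of the one defining [convol f g]. *)
Lemma convolA f g h : nnmeas f -> nnmeas g -> nnmeas h ->
  convol f (convol g h) = convol (convol f g) h.
Proof.
move=> [mf f0] [mg g0] [mh h0]; apply/funext => x; rewrite /convol.
transitivity (\int[mu]_s \int[mu]_r (f (x - s)%R * (g (s - r)%R * h r))).
  apply: eq_integral => s _; rewrite ge0_integralZl//.
  - apply: emeasurable_funM => //; apply: measurableT_comp => //.
    exact: measurable_funB.
  - by move=> r _; rewrite mule_ge0.
pose F (z : measurableTypeR R * measurableTypeR R) :=
  f (x - z.1)%R * (g (z.1 - z.2)%R * h z.2).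
rewrite [LHS](fubini_tonelli (m1 := mu) (m2 := mu) F)/=; last 2 first.
  - apply: emeasurable_funM => /=.
      apply: measurableT_comp => //; exact: measurable_funB.
    by apply: emeasurable_funM => //=; [exact: mshift|exact: measurableT_comp].
  - by move=> z; rewrite !mule_ge0.
apply: eq_integral => r _.
have msh (u : R -> \bar R) (c : R) : measurable_fun [set: R] u ->
    measurable_fun [set: R] (fun s => u (c - s)%R).
  by move=> mu0; apply: measurableT_comp => //; exact: measurable_funB.
under eq_integral do rewrite /F/= muleA.
rewrite ge0_integralZr//; last 2 first.
- apply: emeasurable_funM; first exact: msh.
  by apply: measurableT_comp => //; exact: measurable_funB.
- by move=> s _; rewrite mule_ge0.
congr (_ * _).
rewrite -(@ge0_integral_shift _ (fun s => f (x - s)%R * g (s - r)%R) r).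
- by apply: eq_integral => s _; rewrite addrK opprD addrA addrAC.
- apply: emeasurable_funM; first exact: msh.
  by apply: measurableT_comp => //; exact: measurable_funB.
- by move=> s; rewrite mule_ge0.
Qed.

(** Tonelli again: once the variable of [g] is fixed, the other integral is
    that of a translate of [f]. *)
Lemma integral_convol f g : nnmeas f -> nnmeas g ->
  \int[mu]_x convol f g x = (\int[mu]_x f x) * (\int[mu]_x g x).
Proof.
move=> [mf f0] [mg g0]; rewrite /convol.
pose F (z : measurableTypeR R * measurableTypeR R) := f (z.1 - z.2)%R * g z.2.
rewrite [LHS](fubini_tonelli (m1 := mu) (m2 := mu) F)/=; last 2 first.
  - by apply: emeasurable_funM => //=; [exact: mshift|exact: measurableT_comp].
  - by move=> z; rewrite !mule_ge0.
rewrite -ge0_integralZl//; last exact: integral_ge0.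
apply: eq_integral => s _; rewrite /F/= ge0_integralZr//; last first.
  by apply: measurableT_comp => //; exact: measurable_funB.
congr (_ * _).
by rewrite (ge0_integral_shift (f := f) (- s)%R).
Qed.

Lemma convolZl (c : \bar R) f g : 0 <= c -> nnmeas f -> nnmeas g ->
  convol (fun x => c * f x) g = (fun x => c * convol f g x).
Proof.
move=> c0 [mf f0] [mg g0]; apply/funext => x; rewrite /convol.
under eq_integral do rewrite -muleA.
rewrite ge0_integralZl//.
- apply: emeasurable_funM => //.
  by apply: measurableT_comp => //; exact: measurable_funB.
- by move=> s _; rewrite mule_ge0.
Qed.

End convolution.

(** * Power kernels, Euler's Beta and Gamma functions *)

Section kernels.
Context {R : realType}.
Local Notation mu := (@lebesgue_measure R).
Local Open Scope ereal_scope.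
Implicit Types p q : R.

(** Convolution with [kern p] is the Riemann-Liouville integral of order [p],
    up to the factor [Gamma p]. *)
Definition kern (p x : R) : \bar R := (if 0 < x then x `^ (p - 1) else 0)%:E.

(** The damped kernel is Euler's integrand, and the factor [expR (- x)] is
    multiplicative in [x], so that it goes through convolutions. *)
Definition gkern (p x : R) : \bar R := (expR (- x))%:E * kern p x.

Lemma nnmeas_kern p : nnmeas (kern p).
Proof.
split; last by move=> x; rewrite lee_fin; case: ifP => // _; exact: powR_ge0.
apply/measurable_EFinP; apply: measurable_fun_ifT => //.
exact: measurable_fun_ltr.
Qed.

Lemma nnmeas_gkern p : nnmeas (gkern p).
Proof.
have [mk k0] := nnmeas_kern p; split.
  apply: emeasurable_funM => //; apply/measurable_EFinP.
  by apply: measurableT_comp => //; exact: measurable_funN.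
by move=> x; rewrite mule_ge0// lee_fin expR_ge0.
Qed.

(** Euler's Beta function, for which finiteness has to be proved: hence the
    extended-real value. *)
Definition ebeta p q : \bar R := convol (kern p) (kern q) 1.

(** Homogeneity: the change of variables [s = z * s'] takes the integral at
    [z] to the one at [1], with the factor [z * z^(p-1) * z^(q-1)]. *)
Lemma convol_kern p q :
  convol (kern p) (kern q) = (fun x => ebeta p q * kern (p + q) x).
Proof.
have [mp p0] := nnmeas_kern p; have [mq q0] := nnmeas_kern q.
have mpq (z : R) : measurable_fun [set: R] (fun s => kern p (z - s)%R * kern q s).
  apply: emeasurable_funM => //.
  by apply: measurableT_comp => //; exact: measurable_funB.
apply/funext => z; have [z0|z0] := leP z 0%R.
  rewrite [in RHS]/kern ltNge z0 mule0 /convol integral0_eq// => s _.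
  rewrite /kern; have [s0|s0] := ltP 0%R s; last by rewrite mule0.
  by rewrite ltNge (_ : (z - s <= 0)%R) ?mul0e// subr_le0 (le_trans z0)// ltW.
rewrite /convol (ge0_integral_scale z0)//; last by move=> s; rewrite mule_ge0.
under eq_integral => s _.
  rewrite (_ : _ * _ = (z `^ (p - 1) * z `^ (q - 1))%:E *
                       (kern p (1 - s)%R * kern q s)); last first.
    have -> : (z - z * s = z * (1 - s))%R by rewrite mulrBr mulr1.
    rewrite /kern !pmulr_rgt0//.
    have [s1|s1] := ltP 0%R (1 - s)%R; last by rewrite mul0e mul0e mule0.
    have [s0|s0] := ltP 0%R s; last by rewrite !mule0.
    by rewrite !powRM ?ltW// -!EFinM mulrACA.
  over.
rewrite ge0_integralZl//; last 3 first.
- exact: mpq.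
- by move=> s _; rewrite mule_ge0.
- by rewrite lee_fin mulr_ge0// powR_ge0.
rewrite muleA muleC /ebeta /convol; congr (_ * _).
rewrite /kern z0 -EFinM; congr EFin.
have zD a b : (z `^ (a + b) = z `^ a * z `^ b)%R.
  by rewrite powRD// (gt_eqF z0) implybT.
rewrite -{1}(powRr1 (ltW z0)) -!zD; congr (_ `^ _)%R.
by rewrite addrA [(1 + _)%R]addrCA subrr addr0 addrA.
Qed.

(** The primitive [x^p / p] bounds by [1/p] the integrals over [[1/(n+1), 1]],
    and monotone convergence passes to the limit. *)
Lemma integral_powR_01_lty p : (0 < p)%R ->
  \int[mu]_(x in `]0%R, 1%R]) (x `^ (p - 1))%:E < +oo.
Proof.
move=> p0; pose F n : set R := `[n.+1%:R^-1%R, 1%R]%classic.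
have -> : `]0%R, 1%R]%classic = \bigcup_n F n.
  apply/seteqP; split=> [x|x [n _]]; rewrite /F /= !in_itv/= => /andP[x0 x1].
    exists (Num.truncn x^-1) => //=; rewrite in_itv/= x1 andbT.
    by rewrite invf_ple ?posrE// ltW// truncnS_gt.
  by rewrite x1 andbT (lt_le_trans _ x0)// invr_gt0.
have mpow : measurable_fun [set: R] (fun x : R => (x `^ (p - 1))%:E).
  exact/measurable_EFinP.
apply: (@le_lt_trans _ _ (p^-1)%:E); last exact: ltry.
have cv : \int[mu]_(x in F n) (x `^ (p - 1))%:E @[n --> \oo] -->
    \int[mu]_(x in \bigcup_n F n) (x `^ (p - 1))%:E.
  apply: ge0_nondecreasing_set_cvg_integral.
  - apply/nondecreasing_seqP => n; rewrite subsetEset; apply: subset_itvr.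
    by rewrite bnd_simp lef_pV2 ?posrE// ler_nat.
  - by move=> n; exact: measurable_itv.
  - by move=> n; exact: measurable_funTS.
  - by move=> n x _; rewrite lee_fin powR_ge0.
rewrite -(cvg_lim _ cv)//; apply: lime_le; first exact: cvgP cv.
apply: nearW => -[|n]; rewrite /F.
  by rewrite invr1 set_itv1 integral_set1 lee_fin invr_ge0 ltW.
have a0 : (0 < n.+2%:R^-1 :> R)%R by rewrite invr_gt0.
have a1 : (n.+2%:R^-1 < 1 :> R)%R by rewrite invf_lt1// ltr1n.
have dpow (x : R) : (0 < x)%R ->
    is_derive x 1%R (fun y : R => (p^-1 * y `^ p)%R) (x `^ (p - 1))%R.
  move=> x0; have dx := is_derive1_powR p x0.
  apply: (is_derive_eq (is_deriveZ p^-1 dx)).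
  by rewrite /GRing.scale/= mulrA mulVf ?mul1r// gt_eqF.
have cpow (q x : R) : (0 < x)%R -> {for x, continuous (fun y : R => y `^ q)%R}.
  move=> x0; apply/differentiable_continuous/derivable1_diffP.
  by apply: derivable_powR; rewrite in_itv/= x0.
have cF (x : R) : (0 < x)%R -> {for x, continuous (fun y : R => (p^-1 * y `^ p)%R)}.
  move=> x0; apply/differentiable_continuous/derivable1_diffP.
  by have [] := dpow _ x0.
rewrite (@continuous_FTC2 _ (fun x => x `^ (p - 1))%R (fun x => p^-1 * x `^ p)%R)//.
- rewrite -EFinB lee_fin powR1 mulr1 lerBlDr lerDl.
  by rewrite mulr_ge0// ?powR_ge0// invr_ge0 ltW.
- apply: continuous_in_subspaceT => x; rewrite inE/= in_itv/= => /andP[xa _].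
  by apply: cpow; rewrite (lt_le_trans a0).
- split.
  + move=> x; rewrite in_itv/= => /andP[xa _].
    by have [] := dpow _ (lt_trans a0 xa).
  + apply: cvg_at_right_filter; exact: cF.
  + apply: cvg_at_left_filter; exact: cF.
- move=> x; rewrite in_itv/= => /andP[xa _].
  by rewrite derive1E; have [_ ->] := dpow _ (lt_trans a0 xa).
Qed.

Lemma integral_gkern1 : \int[mu]_x gkern 1 x = 1.
Proof.
rewrite -(@integral_exponential_pdf R 1 ltr01).
transitivity (\int[mu]_(x in `]0%R, +oo[) (expR (- x))%:E).
  rewrite [RHS]integral_mkcond; apply: eq_integral => x _.
  rewrite patchE /gkern /kern mem_setE in_itv/= andbT.
  by case: ifPn => x0; rewrite ?mule0// subrr powRr0 mule1.
rewrite integral_itv_obnd_cbnd; last first.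
  by apply/measurable_EFinP/measurable_funTS; apply: measurableT_comp.
rewrite integral_mkcond; apply: eq_integral => x _.
rewrite /exponential_pdf !patchE; case: ifPn => // _.
by rewrite mul1r mulN1r.
Qed.

Lemma convol_gkern p q :
  convol (gkern p) (gkern q) = (fun x => ebeta p q * gkern (p + q) x).
Proof.
have [mp p0] := nnmeas_kern p; have [mq q0] := nnmeas_kern q.
apply/funext => x.
transitivity ((expR (- x))%:E * convol (kern p) (kern q) x); last first.
  by rewrite convol_kern /gkern muleCA.
rewrite /convol -ge0_integralZl//; last 2 first.
- apply: emeasurable_funM => //.
  by apply: measurableT_comp => //; exact: measurable_funB.
- by move=> s _; rewrite mule_ge0.
apply: eq_integral => s _; rewrite /gkern muleACA.
rewrite -(EFinM (expR _)) -expRD; congr ((expR _)%:E * _).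
by rewrite opprB addrAC subrr sub0r.
Qed.

Definition egamma p : \bar R := \int[mu]_x gkern p x.

Lemma GammaE p : Gamma p = fine (egamma p).
Proof.
rewrite /Gamma /Rintegral /egamma [in LHS]integral_mkcond; congr fine.
apply: eq_integral => x _; rewrite patchE /gkern /kern mem_setE in_itv/= andbT.
by case: ifPn => x0; rewrite ?mule0// -EFinM mulrC.
Qed.

(** The integral of a convolution is the product of the integrals; apply this
    to [gkern p] and [gkern q]. *)
Lemma egamma_beta p q : egamma p * egamma q = ebeta p q * egamma (p + q).
Proof.
have np := nnmeas_gkern p; have nq := nnmeas_gkern q.
transitivity (\int[mu]_x convol (gkern p) (gkern q) x).
  exact/esym/integral_convol.
rewrite convol_gkern ge0_integralZl//.
- exact: (nnmeas_gkern (p + q)).1.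
- by move=> x _; exact: (nnmeas_gkern (p + q)).2.
- exact: (nnmeas_convol (nnmeas_kern p) (nnmeas_kern q)).2.
Qed.

(** On [[1, 2]] the integrand is at least [exp (- 2) / 2]. *)
Lemma egamma_gt0 p : (0 <= p)%R -> 0 < egamma p.
Proof.
move=> p0; have [mg g0] := nnmeas_gkern p.
have c0 : (0 < expR (- 2) / 2 :> R)%R by rewrite divr_gt0// expR_gt0.
apply: (@lt_le_trans _ _ (\int[mu]_(x in `[1%R, 2%R]) (expR (- 2) / 2)%:E)).
  rewrite integral_cst//= lebesgue_measure_itv/= lte_fin ltr1n/=.
  by rewrite -EFinB -EFinM lte_fin mulr_gt0// subr_gt0 ltr1n.
apply: (@le_trans _ _ (\int[mu]_(x in `[1%R, 2%R]) gkern p x)); last first.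
  by apply: ge0_subset_integral => //; exact: measurable_funTS.
apply: ge0_le_integral => //.
- exact: measurable_funTS.
move=> x; rewrite /= in_itv/= => /andP[x1 x2].
have x0 : (0 < x)%R by rewrite (lt_le_trans _ x1).
rewrite /gkern /kern x0 -EFinM lee_fin ler_pM ?expR_ge0//.
  by rewrite ler_expR lerN2.
apply: (@le_trans _ _ (x `^ (- 1))%R).
  by rewrite (powR_inv1 (ltW x0)) lef_pV2 ?posrE.
by apply: ler_powR => //; rewrite lerDr.
Qed.

Lemma ebeta_ge0 p q : 0 <= ebeta p q.
Proof. exact: (nnmeas_convol (nnmeas_kern p) (nnmeas_kern q)).2. Qed.

(** Otherwise [egamma p * egamma q] would vanish. *)
Lemma ebeta_neq0 p q : (0 < p)%R -> (0 < q)%R -> ebeta p q != 0.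
Proof.
move=> p0 q0; apply/eqP => B0; have := egamma_beta p q.
rewrite B0 mul0e; apply/eqP.
by apply: mule_neq0; rewrite gt_eqF//; apply: egamma_gt0; exact: ltW.
Qed.

(** Inserting [1 = (1 - x) + x] gives
    [(1-x)^(p-1) x^(q-1) = (1-x)^p x^(q-1) + (1-x)^(p-1) x^q]
    on [0 < x < 1], and each summand has only one, integrable, singularity. *)
Lemma ebeta_lty p q : (0 < p)%R -> (0 < q)%R -> ebeta p q < +oo.
Proof.
move=> p0 q0.
pose c (r x : R) : \bar R := ((fun x : R => (x `^ (r - 1))%:E) \_ `]0%R, 1%R]) x.
have mc r : measurable_fun [set: R] (c r).
  apply/(measurable_restrictT _ _).1 => //; apply: measurable_funTS.
  exact/measurable_EFinP.
have c0 r x : 0 <= c r x.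
  by rewrite /c patchE; case: ifP => // _; rewrite lee_fin powR_ge0.
have cE r x : (0 < x)%R -> (x <= 1)%R -> c r x = (x `^ (r - 1))%:E.
  by move=> x0 x1; rewrite /c patchE mem_set//= in_itv/= x0.
have ci r : (0 < r)%R -> \int[mu]_x c r x < +oo.
  by move=> r0; rewrite /c -integral_mkcond; exact: integral_powR_01_lty.
have mcr : measurable_fun [set: R] (fun x => c p (1 - x)%R).
  by apply: measurableT_comp => //; exact: measurable_funB.
apply: (@le_lt_trans _ _ (\int[mu]_x (c p (1 - x)%R + c q x))).
  rewrite /ebeta /convol; apply: ge0_le_integral => //.
  - move=> x _; rewrite mule_ge0//; [exact: (nnmeas_kern p).2|exact: (nnmeas_kern q).2].
  - apply: emeasurable_funM; last exact: (nnmeas_kern q).1.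
    by apply: measurableT_comp; [exact: (nnmeas_kern p).1|exact: measurable_funB].
  - exact: (emeasurable_funD mcr (mc q)).
  move=> x _.
  have [x1|x1] := ltP 0%R (1 - x)%R; last first.
    by rewrite /kern ltNge x1/= mul0e; exact: adde_ge0.
  have [x0|x0] := ltP 0%R x; last first.
    by rewrite [kern q x]/kern ltNge x0/= mule0; exact: adde_ge0.
  have x1' : (x <= 1)%R by rewrite ltW// -subr_gt0.
  have x0' : (1 - x <= 1)%R by rewrite lerBlDr lerDl ltW.
  have pow_le1 (r y : R) : (0 <= r)%R -> (0 <= y)%R -> (y <= 1)%R -> (y `^ r <= 1)%R.
    move=> r0 y0 y1.
    by rewrite (le_trans (ge0_ler_powR r0 _ _ y1)) ?nnegrE// powR1.
  rewrite !cE// /kern x0 x1 -EFinM -EFinD lee_fin.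
  (* Write the left-hand side as [(1 - x + x)] times itself. *)
  rewrite -[X in (X <= _)%R]mul1r -{1}(subrK x 1%R) mulrDl mulrA.
  rewrite (mulr_powRB1 (ltW x1) p0) mulrCA (mulr_powRB1 (ltW x0) q0) addrC.
  apply: lerD.
    rewrite ler_piMr ?powR_ge0//.
    exact: pow_le1 (ltW q0) (ltW x0) x1'.
  rewrite ler_piMl ?powR_ge0//.
  exact: pow_le1 (ltW p0) (ltW x1) x0'.
have -> : \int[mu]_x (c p (1 - x)%R + c q x) =
    \int[mu]_x c p (1 - x)%R + \int[mu]_x c q x.
  by apply: ge0_integralD => //; exact: mc.
rewrite (ge0_integral_reflect 1 (mc p) (c0 p)).
by rewrite lte_add_pinfty// ci.
Qed.

Lemma gt0_mule_fin (X Y B : \bar R) : 0 < X -> 0 < Y -> X * Y = B -> B < +oo ->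
  [/\ (0 < fine X)%R, (0 < fine Y)%R & B = (fine X * fine Y)%:E].
Proof.
case: X Y => [r| |] [s| |]// X0 Y0 <-;
  by rewrite ?gt0_muley ?gt0_mulye.
Qed.

(** Here [Gamma 2 = 1], so that the Beta integral is the product of the two
    Gamma integrals; its finiteness and their positivity make both of them
    finite, hence equal to the real-valued [Gamma]. *)
Lemma beta_Gamma (b : R) : (0 < b < 1)%R ->
  [/\ (0 < Gamma (1 - b))%R, (0 < Gamma (1 + b))%R &
     ebeta (1 - b) (1 + b) = (Gamma (1 - b) * Gamma (1 + b))%:E].
Proof.
move=> /andP[b0 b1].
have pN : (0 < 1 - b)%R by rewrite subr_gt0.
have pD : (0 < 1 + b)%R by rewrite addr_gt0.
(* [Gamma 2 = 1] follows from [Gamma 1 = 1] and [B(1, 1) = 1]. *)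
have e1 : egamma 1 = 1 := integral_gkern1.
have b11 : ebeta 1 1 = 1.
  transitivity (\int[mu]_(x in `]0%R, 1%R[) (1 : \bar R)).
    rewrite [RHS]integral_mkcond; apply: eq_integral => x _.
    rewrite patchE mem_setE in_itv/= /kern !subrr !powRr0 subr_gt0.
    have [x0|x0] := ltP 0%R x; have [x1|x1] := ltP x 1%R;
      by rewrite /= ?mule1 ?mule0 ?mul0e.
  by rewrite integral_cst//= lebesgue_measure_itv/= lte_fin ltr01 mul1e -EFinB subr0.
have e2 : egamma 2 = 1 by have := egamma_beta 1 1; rewrite b11 e1 !mul1e => ->.
have eB : egamma (1 - b) * egamma (1 + b) = ebeta (1 - b) (1 + b).
  apply: (etrans (egamma_beta _ _)); rewrite -[RHS]mule1; congr (_ * _).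
  by rewrite -[RHS]e2; congr egamma; rewrite addrACA addNr addr0.
rewrite !GammaE.
apply: gt0_mule_fin eB (ebeta_lty pN pD); apply: egamma_gt0; exact: ltW.
Qed.

End kernels.

(** * Elementary calculus of Jumarie's derivative *)

Section jumarie_calculus.
Context {R : realType}.
Local Notation mu := (@lebesgue_measure R).
Implicit Types (a b c d x y s t : R) (h : R -> R).

Lemma dnbhs_half_proper x : 0 <= x -> ProperFilter (dnbhs_half x).
Proof.
move=> x0; apply: Build_ProperFilter; rewrite /dnbhs_half /within /= => x0F.
suff F : \forall y \near x^'+, False by have [] := filter_ex F.
apply: (@filterS _ (nbhs x) _ _ _ _ x0F) => y /= yF xy.
by apply: yF; rewrite ?in_itv/= ?gt_eqF ?andbT// (le_trans x0)// ltW.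
Qed.

(** Away from the origin the half-line constraint is local and the derivative
    is the usual one. *)
Lemma gt0_dnbhs_half x : 0 < x -> dnbhs_half x = x^'.
Proof.
move=> x0; apply/seteqP; split => A; rewrite /dnbhs_half /within /= => xA.
  have xI : \forall y \near x^', y \in `[0, +oo[.
    apply: nbhs_dnbhs; near=> y; rewrite in_itv/= andbT ltW//.
    by near: y; exact: lt_nbhsr.
  by apply: filterS2 xA xI => y Ay yI; exact: Ay.
by apply: filterS xA.
Unshelve. all: by end_near. Qed.

Definition jumarie_integrable a h := forall y, 0 <= y ->
  mu.-integrable `[0, y] (EFin \o jumarie_integrand a h y).

Lemma jumarie_integral_lt0 a h y : y < 0 -> jumarie_integral a h y = 0.
Proof.
by move=> y0; rewrite /jumarie_integral set_itv_ge ?Rintegral_set0// bnd_simp -ltNge.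
Qed.

(** The slopes of a linear function are constant, so the limit is immediate,
    one-sided at the origin included; constants and powers fall under this
    case. *)
Lemma jumarie_linear a h c x : 0 <= x -> jumarie_integrable a h ->
  (forall y, 0 <= y -> jumarie_integral a h y = c * y) ->
  jumarie_derivable a h x /\ jumarie a h x = (Gamma (1 - a))^-1 * c.
Proof.
move=> x0 hi hc.
have PF := dnbhs_half_proper x0.
have sc : slope (jumarie_integral a h) x y @[y --> dnbhs_half x] --> c.
  apply: cvg_near_cst; rewrite near_withinE near_withinE; apply: nearW => y yx.
  rewrite /= in_itv/= andbT => y0; rewrite /slope !hc// -mulrBr mulfK//.
  by rewrite subr_eq0.
split; first by split=> //; apply: cvgP sc.
by rewrite /jumarie (cvg_lim _ sc).
Qed.

(** Linearity and insensitivity to constants in one statement; the case [c2 = 0]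
    is that of an affine image.  The functions are compared on the half-line
    only, where the definition looks at them. *)
Lemma jumarie_lincomb a h h1 h2 c1 c2 d x : 0 <= x ->
  (forall s, 0 <= s -> h s = c1 * h1 s + c2 * h2 s + d) ->
  jumarie_derivable a h1 x -> jumarie_derivable a h2 x ->
  jumarie_derivable a h x /\
  jumarie a h x = c1 * jumarie a h1 x + c2 * jumarie a h2 x.
Proof.
move=> x0 hE [i1 s1] [i2 s2]; have PF := dnbhs_half_proper x0.
have iE y s : 0 <= s -> jumarie_integrand a h y s =
    c1 * jumarie_integrand a h1 y s + c2 * jumarie_integrand a h2 y s.
  move=> s0; rewrite /jumarie_integrand !hE//.
  by ring.
have iZ k g y : mu.-integrable `[0, y] (EFin \o g) ->
    mu.-integrable `[0, y] (EFin \o (fun s => k * g s)).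
  move=> gi; have -> : EFin \o (fun s => k * g s) = (fun s => k%:E * (g s)%:E)%E.
    by apply/funext => s; rewrite /= EFinM.
  exact: integrableZl.
have hi : forall y, 0 <= y ->
    mu.-integrable `[0, y] (EFin \o jumarie_integrand a h y).
  move=> y y0.
  have : mu.-integrable `[0, y]
      ((EFin \o (fun s => c1 * jumarie_integrand a h1 y s)%R) \+
       (EFin \o (fun s => c2 * jumarie_integrand a h2 y s)%R))%E.
    by apply: integrableD => //; [exact: iZ (i1 y y0)|exact: iZ (i2 y y0)].
  apply: eq_integrable => // s; rewrite inE/= in_itv/= => /andP[s0 _].
  by rewrite iE// EFinD.
have JE y : jumarie_integral a h y =
    c1 * jumarie_integral a h1 y + c2 * jumarie_integral a h2 y.
  have [y0|y0] := ltP y 0.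
    by rewrite !jumarie_integral_lt0// !mulr0 addr0.
  rewrite /jumarie_integral -!RintegralZl//; [|exact: i2|exact: i1].
  rewrite -RintegralD//; [|exact: iZ (i1 y y0)|exact: iZ (i2 y y0)].
  by apply: eq_Rintegral => s; rewrite inE/= in_itv/= => /andP[s0 _]; exact: iE.
have sE : slope (jumarie_integral a h) x = (fun y =>
    c1 * slope (jumarie_integral a h1) x y + c2 * slope (jumarie_integral a h2) x y).
  apply/funext => y; rewrite /slope !JE !mulrA -mulrDl; congr (_ / _).
  by rewrite !mulrBr opprD addrACA.
have sc : (c1 * slope (jumarie_integral a h1) x y +
     c2 * slope (jumarie_integral a h2) x y) @[y --> dnbhs_half x] -->
    c1 * lim (slope (jumarie_integral a h1) x y @[y --> dnbhs_half x]) +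
    c2 * lim (slope (jumarie_integral a h2) x y @[y --> dnbhs_half x]).
  exact: cvgD (cvgM (cvg_cst c1) s1) (cvgM (cvg_cst c2) s2).
have hcv : cvg (slope (jumarie_integral a h) x y @[y --> dnbhs_half x]).
  by rewrite sE; apply: cvgP sc.
split; first exact: (conj hi hcv).
rewrite /jumarie sE (cvg_lim _ sc)// mulrDr.
by congr (_ + _); rewrite mulrCA.
Qed.

End jumarie_calculus.

(** * The power rule *)

Section jumarie_convolution.
Context {R : realType}.
Local Notation mu := (@lebesgue_measure R).
Local Open Scope ereal_scope.
Implicit Types (a b c d x y s t : R) (h : R -> R).

(** Extended by zero to the left of the origin, so that a fractional integral
    over [[0, y]] becomes a convolution on the whole line. *)
Definition increment h : R -> \bar R :=
  (fun s => (h s - h 0%R)%:E) \_ `[0%R, +oo[.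

(** At [s = y] both sides vanish, the left one because [0 `^ (- a) = 0]. *)
Lemma jumarie_integrand_kern a h y : a != 0%R ->
  (EFin \o jumarie_integrand a h y) \_ `[0%R, y] =
  (fun s => kern (1 - a) (y - s)%R * increment h s).
Proof.
move=> a0; apply/funext => s; rewrite /increment !patchE !mem_setE !in_itv/= andbT.
rewrite /kern subr_gt0.
have [s0|s0] := leP 0%R s; last by rewrite mule0.
rewrite /jumarie_integrand; have [sy|ys|->] := ltgtP s y => /=.
- by rewrite addrAC subrr add0r EFinM.
- by rewrite mul0e.
- by rewrite subrr powR0 ?oppr_eq0// mul0r mul0e.
Qed.

Lemma jumarie_integralE a h y : a != 0%R ->
  jumarie_integral a h y = fine (convol (kern (1 - a)) (increment h) y).
Proof.
move=> a0; rewrite /jumarie_integral /Rintegral integral_mkcond.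
by rewrite jumarie_integrand_kern.
Qed.

Lemma increment_powR b : (0 < b)%R -> increment (@powR R ^~ b) = kern (1 + b).
Proof.
move=> b0; apply/funext => s; rewrite /increment /kern patchE mem_setE in_itv/= andbT.
rewrite powR0 ?gt_eqF// subr0 [(1 + b)%R]addrC addrK.
by case: ltgtP => // <-; rewrite powR0 ?gt_eqF.
Qed.

(** The increment of [x^b] is itself the kernel [kern (1 + b)], so its
    fractional integral is [B(1 - b, 1 + b) kern 2], linear with slope
    [Gamma (1 - b) * Gamma (1 + b)]. *)
Lemma jumarie_powR b x : (0 < b < 1)%R -> (0 <= x)%R ->
  jumarie_derivable b (@powR R ^~ b) x /\ jumarie b (@powR R ^~ b) x = Gamma (1 + b).
Proof.
move=> b01 x0; have /andP[b0 b1] := b01.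
have bn0 : b != 0%R by rewrite gt_eqF.
have [GN GD eB] := beta_Gamma b01.
have cE y : (0 <= y)%R -> convol (kern (1 - b)) (increment (@powR R ^~ b)) y =
    (Gamma (1 - b) * Gamma (1 + b) * y)%:E.
  move=> y0; rewrite increment_powR// convol_kern eB [RHS]EFinM; congr (_ * _).
  rewrite /kern (_ : 1 - b + (1 + b) - 1 = 1)%R; last by ring.
  case: ltgtP y0 => // [y0 _|<- //].
  by rewrite powRr1// ltW.
have hi : jumarie_integrable b (@powR R ^~ b).
  move=> y y0; apply/integrable_mkcond => //.
  rewrite jumarie_integrand_kern//; apply/integrableP; split.
    rewrite increment_powR//; apply: emeasurable_funM; last exact: (nnmeas_kern _).1.
    apply: measurableT_comp; first exact: (nnmeas_kern _).1.
    exact: measurable_funB.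
  apply: le_lt_trans (ltry (Gamma (1 - b) * Gamma (1 + b) * y)).
  rewrite -cE// /convol le_eqVlt; apply/orP; left; apply/eqP.
  apply: eq_integral => s _; rewrite gee0_abs// increment_powR// mule_ge0//.
    exact: (nnmeas_kern _).2.
  exact: (nnmeas_kern _).2.
have hc y : (0 <= y)%R -> jumarie_integral b (@powR R ^~ b) y =
    (Gamma (1 - b) * Gamma (1 + b) * y)%R.
  by move=> y0; rewrite jumarie_integralE// cE.
have [hd ->] := jumarie_linear x0 hi hc; split=> //.
by rewrite mulKf// gt_eqF.
Qed.

Lemma jumarie_cst a h c x : (0 <= x)%R -> (forall s, (0 <= s)%R -> h s = c) ->
  jumarie_derivable a h x /\ jumarie a h x = 0%R.
Proof.
move=> x0 hE.
have E y : {in `[0%R, y]%classic, jumarie_integrand a h y =1 cst 0%R}.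
  move=> s; rewrite inE/= in_itv/= => /andP[s0 _].
  by rewrite /jumarie_integrand !hE// subrr mulr0.
have hi : jumarie_integrable a h.
  move=> y y0; apply: (@eq_integrable _ _ _ mu _ _ (cst 0)) => //; last exact: integrable0.
  by move=> s sy; rewrite /= E.
have [|hd ->] := jumarie_linear (c := 0%R) x0 hi; last by rewrite mulr0.
move=> y y0; rewrite mul0r /jumarie_integral /Rintegral integral0_eq// => s sy.
by rewrite (E y s) ?inE.
Qed.

End jumarie_convolution.

(** * Functions with zero fractional derivative *)

Section uniqueness.
Context {R : realType}.
Local Notation mu := (@lebesgue_measure R).
Implicit Types (a b c d x y s t : R) (h : R -> R).

(** Caratheodory's form of the derivative is the statement about slopes, with
    the value [l] filled in at [t]. *)
Lemma slope_is_derive (F : R -> R) t l :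
  slope F t y @[y --> t^'] --> l -> is_derive t 1 F l.
Proof.
move=> cF; apply/is_derive1_caratheodory.
exists (fun z => if z == t then l else slope F t z); split; last by rewrite eqxx.
- move=> z; have [->|zt] := eqVneq z t; first by rewrite !subrr mulr0.
  by rewrite /slope divfK// subr_eq0.
- apply/continuous_withinNx; rewrite eqxx; apply: cvg_trans cF.
  apply: near_eq_cvg; near=> z; rewrite ifN//.
  by near: z; exact: nbhs_dnbhs_neq.
Unshelve. all: by end_near. Qed.

Lemma is_derive0_pos_cst (F : R -> R) :
  (forall t, 0 < t -> is_derive t 1 F 0) ->
  forall x y, 0 < x -> x <= y -> F y = F x.
Proof.
move=> dF x y x0 xy.
have dFxy t : t \in `]x, y[ -> is_derive t 1 F 0.
  by rewrite in_itv/= => /andP[xt _]; apply: dF; exact: lt_trans xt.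
have [|c _] := MVT_segment xy dFxy; last by rewrite mul0r => /eqP; rewrite subr_eq0 => /eqP.
apply: continuous_in_subspaceT => t; rewrite inE/= in_itv/= => /andP[xt _].
apply/differentiable_continuous/derivable1_diffP.
by have [] := dF _ (lt_le_trans x0 xt).
Qed.

(** Compare with the fractional integral of the constant [1], which is the
    convolution of [kern (1 - a)] with [kern 1]. *)
Lemma normr_jumarie_integral_le a h e : 0 < a < 1 -> 0 < e ->
  jumarie_integrable a h ->
  (forall s, 0 <= s <= e -> `|h s - h 0| <= 1) ->
  `|jumarie_integral a h e| <= fine (ebeta (1 - a) 1) * e `^ (1 - a).
Proof.
move=> /andP[a0 a1] e0 hi h1; have a10 : 0 < 1 - a by rewrite subr_gt0.
have ie := hi _ (ltW e0); have [mie _] := integrableP _ _ _ ie.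
have Bfin : ebeta (1 - a) 1 \is a fin_num.
  by rewrite ge0_fin_numE; [exact: ebeta_lty|exact: ebeta_ge0].
have -> : fine (ebeta (1 - a) 1) * e `^ (1 - a) =
    fine (convol (kern (1 - a)) (kern 1) e).
  rewrite convol_kern /kern e0 fineM//; congr (_ * _ `^ _).
  by rewrite addrK.
have kk_fin : convol (kern (1 - a)) (kern 1) e \is a fin_num.
  by rewrite convol_kern fin_numM.
rewrite -lee_fin fineK// /jumarie_integral EFin_normr_Rintegral//.
have mk : measurable_fun [set: R] (fun s => kern (1 - a) (e - s) * kern 1 s)%E.
  apply: emeasurable_funM; last exact: (nnmeas_kern _).1.
  by apply: measurableT_comp; [exact: (nnmeas_kern _).1|exact: measurable_funB].
have k0 s : (0 <= kern (1 - a) (e - s)%R * kern 1 s)%E.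
  by rewrite mule_ge0//; [exact: (nnmeas_kern (1 - a)).2|exact: (nnmeas_kern 1).2].
apply: (le_trans (le_abse_integral _ _ _)) => //.
apply: (@le_trans _ _ (\int[mu]_(s in `[0%R, e]) (kern (1 - a) (e - s) * kern 1 s))%E).
  apply: ge0_le_integral => //.
  - exact: measurableT_comp.
  - exact: measurable_funTS.
  move=> s; rewrite /= in_itv/= => /andP[s0 se].
  rewrite /jumarie_integrand /kern normrM lee_fin ger0_norm ?powR_ge0// subr_gt0.
  move: se s0; rewrite le_eqVlt => /predU1P[-> _|se].
    by rewrite subrr powR0 ?oppr_eq0 ?gt_eqF// mul0r ltxx mul0r.
  rewrite se addrAC subrr add0r powRr0.
  rewrite le_eqVlt => /predU1P[<-|s0]; first by rewrite subrr normr0 ltxx.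
  by rewrite s0 ler_wpM2l ?powR_ge0// h1// !ltW.
by apply: ge0_subset_integral => //; exact: measurable_funTS.
Qed.

(** The fractional integral is constant on [t > 0], and it tends to [0] at the
    origin by [normr_jumarie_integral_le], continuity bounding the increment
    by [1] near [0]. *)
Lemma jumarie_eq0_integral_eq0 a h : 0 < a < 1 ->
  {within `[0, +oo[, continuous h} ->
  (forall t, 0 < t -> jumarie_derivable a h t /\ jumarie a h t = 0) ->
  forall y, 0 <= y -> jumarie_integral a h y = 0.
Proof.
move=> a01 ch hd y y0; have /andP[a0 a1] := a01.
have hi : jumarie_integrable a h by have [[]] := hd 1 ltr01.
have [GN _ _] := beta_Gamma a01.
have dJ t : 0 < t -> is_derive t 1 (jumarie_integral a h) 0.
  move=> t0; apply: slope_is_derive; have [[_]] := hd t t0.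
  rewrite /jumarie (gt0_dnbhs_half t0) => cs /eqP.
  by rewrite mulf_eq0 invr_eq0 (gt_eqF GN)/= => /eqP <-.
move: y0; rewrite le_eqVlt => /predU1P[<-|y0].
  by rewrite /jumarie_integral set_itv1 Rintegral_set1.
have near1 : \forall e \near 0^'+, forall s, 0 <= s <= e -> `|h s - h 0| <= 1.
  have [_ /cvgrPdist_le/(_ 1 ltr01)] := (continuous_within_itvcyP _ _).1 ch.
  rewrite near_withinE => /nbhs_ballP[d /= d0 dP].
  near=> e => s /andP[]; rewrite le_eqVlt => /predU1P[<- _|s0 se].
    by rewrite subrr normr0.
  rewrite distrC; apply: dP => //; rewrite /ball/= sub0r normrN gtr0_norm//.
  by rewrite (le_lt_trans se)//; near: e; exact: nbhs_right_lt.
apply/eqP; rewrite -normr_le0.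
have a10 : 0 < 1 - a by rewrite subr_gt0.
have cB : fine (ebeta (1 - a) 1) * e `^ (1 - a) @[e --> 0^'+] --> 0.
  rewrite -[X in _ --> X](mulr0 (fine (ebeta (1 - a) 1))).
  by apply: cvgM; [exact: cvg_cst|exact: powR_cvg0].
rewrite -(cvg_lim _ cB)//; apply: limr_ge; first exact: cvgP cB.
near=> e.
have e0 : 0 < e by [].
rewrite (is_derive0_pos_cst dJ (x := e))//; last first.
  by near: e; apply: nbhs_right_ltW.
apply: normr_jumarie_integral_le => //.
by near: e.
Unshelve. all: by end_near. Qed.

Lemma measurable_increment h : {within `[0, +oo[, continuous h} ->
  measurable_fun [set: R] (increment h).
Proof.
move=> ch; apply/(measurable_restrictT _ _).1 => //.
apply/measurable_EFinP; apply: measurable_funB => //.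
exact: subspace_continuous_measurable_fun.
Qed.

Lemma ge0_mule_funepos_funeneg (T : Type) (k f : T -> \bar R) :
  (forall z, k z \is a fin_num) -> (forall z, (0 <= k z)%E) ->
  (fun z => k z * f z)^\+%E = (fun z => k z * f^\+ z)%E /\
  (fun z => k z * f z)^\-%E = (fun z => k z * f^\- z)%E.
Proof.
move=> kfin k0.
have kE z : k z = (fine (k z))%:E by rewrite fineK.
have fk0 z : 0 <= fine (k z) by exact: fine_ge0.
split; apply/funext => z.
- rewrite kE -[RHS](congr1 (@^~ z) (ge0_funeposM f (fk0 z))).
  by rewrite funepos.unlock kE.
- rewrite kE -[RHS](congr1 (@^~ z) (ge0_funenegM f (fk0 z))).
  by rewrite funeneg.unlock kE.
Qed.

(** The difference of the two convolutions is the fractional integral of the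
    increment of [h]; both are finite by integrability, so they can be
    compared. *)
Lemma convol_increment_pos_neg a h : 0 < a < 1 ->
  jumarie_integrable a h ->
  (forall y, 0 <= y -> jumarie_integral a h y = 0) ->
  convol (kern (1 - a)) (increment h)^\+%E =
  convol (kern (1 - a)) (increment h)^\-%E.
Proof.
move=> /andP[a0 a1] hi h0; have an0 : a != 0 by rewrite gt_eqF.
apply/funext => y.
have fE := jumarie_integrand_kern h y an0.
set f := (_ \_ _) in fE.
have fi : mu.-integrable [set: R] f.
  rewrite /f -integrable_mkcond//; have [y0|y0] := leP 0 y; first exact: hi.
  by rewrite set_itv_ge ?bnd_simp -?ltNge//; exact: integrable_set0.
have f0 : (\int[mu]_x f x = 0)%E.
  have ff := integrable_fin_num measurableT fi.
  rewrite -(fineK ff) /f -integral_mkcond; congr EFin.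
  have [y0|y0] := leP 0 y; first exact: h0.
  exact: jumarie_integral_lt0.
have [fpE fnE] := @ge0_mule_funepos_funeneg _ (fun s => kern (1 - a) (y - s))
  (increment h) (fun=> isT) (fun=> (nnmeas_kern _).2 _).
have pE : convol (kern (1 - a)) (increment h)^\+%E y = (\int[mu]_x f^\+ x)%E.
  by rewrite fE fpE.
have nE : convol (kern (1 - a)) (increment h)^\-%E y = (\int[mu]_x f^\- x)%E.
  by rewrite fE fnE.
rewrite pE nE.
have pfin := integrable_pos_fin_num measurableT fi.
have nfin := integrable_neg_fin_num measurableT fi.
move: f0; rewrite integralE -(fineK pfin) -(fineK nfin) -EFinB => -[] /eqP.
by rewrite subr_eq0 => /eqP ->.
Qed.

(** Abel's inversion: convolving with [kern a] turns [kern (1 - a)] into a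
    finite nonzero multiple of [kern 1]. *)
Lemma convol_kern_inj a (P N : R -> \bar R) : 0 < a < 1 ->
  nnmeas P -> nnmeas N ->
  convol (kern (1 - a)) P = convol (kern (1 - a)) N ->
  convol (kern 1) P = convol (kern 1) N.
Proof.
move=> /andP[a0 a1] nP nN PN; have a10 : 0 < 1 - a by rewrite subr_gt0.
have B0 := ebeta_ge0 a (1 - a).
have Bfin : ebeta a (1 - a) \is a fin_num.
  by rewrite ge0_fin_numE//; exact: ebeta_lty.
have Bn0 : fine (ebeta a (1 - a)) != 0.
  rewrite fine_eq0//; exact: ebeta_neq0.
have E Q : nnmeas Q -> convol (kern a) (convol (kern (1 - a)) Q) =
    (fun x => (ebeta a (1 - a) * convol (kern 1) Q x)%E).
  move=> nQ; apply: (etrans (convolA (nnmeas_kern a) (nnmeas_kern (1 - a)) nQ)).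
  have -> : convol (kern a) (kern (1 - a)) = (fun x => (ebeta a (1 - a) * kern 1 x)%E).
    by rewrite convol_kern (_ : a + (1 - a) = 1)//; ring.
  exact: convolZl B0 (nnmeas_kern 1) nQ.
have BE := etrans (esym (E P nP)) (etrans (congr1 (convol (kern a)) PN) (E N nN)).
apply/funext => x.
have /(congr1 (mule (fine (ebeta a (1 - a)))^-1%:E)) := congr1 (@^~ x) BE.
rewrite !muleA -{2 4}(fineK Bfin) -EFinM mulVf// !mul1e.
by move->.
Qed.

(** [kern 1] is the indicator of the positive half-line, so that integration
    of order [1] is the ordinary primitive from the origin. *)
Lemma convol_kern1 (g : R -> \bar R) x : 0 < x ->
  measurable_fun [set: R] g -> (forall s, s < 0 -> g s = 0%E) ->
  convol (kern 1) g x = (\int[mu]_(s in `[0%R, x]) g s)%E.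
Proof.
move=> x0 mg g0; rewrite -integral_itv_bndo_bndc; last exact: measurable_funTS.
rewrite [RHS]integral_mkcond; apply: eq_integral => s _.
rewrite patchE mem_setE in_itv/= /kern subr_gt0 subrr powRr0.
have [s0|s0] := leP 0 s; last by rewrite g0// mule0.
by case: ltP => _; rewrite ?mul1e ?mul0e.
Qed.

(** By Abel's inversion the increments of [h] have a zero primitive; the
    fundamental theorem of calculus gives back the increments, by
    continuity. *)
Lemma jumarie_eq0_cst a h : 0 < a < 1 ->
  {within `[0, +oo[, continuous h} ->
  (forall t, 0 < t -> jumarie_derivable a h t /\ jumarie a h t = 0) ->
  forall t, 0 <= t -> h t = h 0.
Proof.
move=> a01 ch hd t; rewrite le_eqVlt => /predU1P[<-//|t0].
have hi : jumarie_integrable a h by have [[]] := hd 1 ltr01.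
have mg := measurable_increment ch.
have nP : nnmeas (increment h)^\+%E.
  by split; [exact: measurable_funepos|move=> x; exact: funepos_ge0].
have nN : nnmeas (increment h)^\-%E.
  by split; [exact: measurable_funeneg|move=> x; exact: funeneg_ge0].
have PN := convol_kern_inj a01 nP nN
  (convol_increment_pos_neg a01 hi (jumarie_eq0_integral_eq0 a01 ch hd)).
have g0 s : s < 0 -> increment h s = 0%E.
  by move=> s0; rewrite /increment patchE mem_setE in_itv/= andbT leNgt s0.
have hI x : 0 < x -> mu.-integrable `[0, x] (EFin \o (fun s => h s - h 0)).
  move=> x0; apply: continuous_compact_integrable; first exact: segment_compact.
  have sub : (`[0, x] `<=` `[0, +oo[)%classic by exact: subset_itvl.
  move=> s; apply: continuousB; last exact: cst_continuous.
  exact: continuous_subspaceW sub ch s.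
have gI x : 0 < x -> mu.-integrable `[0, x] (increment h).
  move=> x0; apply: eq_integrable (hI x x0) => // s.
  rewrite inE/= in_itv/= => /andP[s0 _].
  by rewrite /increment patchE mem_setE in_itv/= s0.
have int0 x : 0 < x -> \int[mu]_(s in `[0, x]) (h s - h 0) = 0.
  move=> x0; rewrite /Rintegral.
  rewrite (_ : \int[mu]_(s in _) _ = \int[mu]_(s in `[0%R, x]) increment h s)%E; last first.
    apply: eq_integral => s; rewrite inE/= in_itv/= => /andP[s0 _].
    by rewrite /increment patchE mem_setE in_itv/= s0.
  rewrite integralE -!convol_kern1//; last 4 first.
  - exact: nN.1.
  - by move=> s s0; rewrite funeneg.unlock g0// oppe0 maxxx.
  - exact: nP.1.
  - by move=> s s0; rewrite funepos.unlock g0// maxxx.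
  rewrite PN subee// convol_kern1//; last 2 first.
  - exact: nN.1.
  - by move=> s s0; rewrite funeneg.unlock g0// oppe0 maxxx.
  by apply: integrable_neg_fin_num => //; exact: gI.
have ct : {for t, continuous (fun s => h s - h 0)}.
  have [/(_ t) cht _] := (continuous_within_itvcyP _ _).1 ch.
  by apply: cvgB; [apply: cht; rewrite in_itv/= t0|exact: cvg_cst].
have tt : t < t + 1 by rewrite ltrDl.
have [_] := continuous_FTC1_closed tt (hI _ (lt_trans t0 tt)) t0 ct.
rewrite derive1E (near_eq_derive (g := cst 0)); last first.
  near=> x; apply: int0; near: x; exact: lt_nbhsr.
by rewrite derive_cst => /eqP; rewrite eq_sym subr_eq0 => /eqP.
Unshelve. all: by end_near. Qed.

End uniqueness.

(** * Similarity reduction of Burgers' equation *)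

Section burgers_lemmas.
Context {R : realType}.
Implicit Types (a b m n t x y : R) (f g G phi : R -> R) (u : R -> R -> R).

Lemma within_continuous_comp_sub (T U V : topologicalType) (A : set T) (B : set U)
    (f : T -> U) (g : U -> V) :
  (forall z : T, A z -> B (f z)) ->
  {within A, continuous f} -> {within B, continuous g} ->
  {within A, continuous (g \o f)}.
Proof.
move=> AB /subspace_continuousP cf /subspace_continuousP cg.
apply/subspace_continuousP => x Ax.
apply: (cvg_comp _ _ _ (cg _ (AB _ Ax))) => P /=.
rewrite /within/= => PB; have /= := cf x Ax _ PB.
rewrite /fmap /within /nbhs/=; apply: (@filterS _ (nbhs x)) => z /= Pz Az.
exact: Pz Az (AB z Az).
Qed.

Lemma similarity_var_continuous a : 0 < a ->
  {within `[0, +oo[, continuous (similarity_var a)}.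
Proof.
move=> a0; have cp : {within `[0, +oo[, continuous (@powR R ^~ a)}.
  apply/continuous_within_itvcyP; split=> [x|].
    rewrite in_itv/= andbT => x0.
    apply/differentiable_continuous/derivable1_diffP.
    by apply: derivable_powR; rewrite in_itv/= x0.
  by rewrite powR0 ?gt_eqF//; exact: powR_cvg0.
by move=> x; exact: continuousM (cp x) (@cst_continuous _ _ (Gamma (1 + a))^-1 x).
Qed.

Lemma similarity_var_ge0 a t : 0 < a < 1 -> 0 <= similarity_var a t.
Proof.
by move=> a01; have [_ G0 _] := beta_Gamma a01; rewrite divr_ge0 ?powR_ge0// ltW.
Qed.

(** The similarity variable is a bijection of the half-line, so any function
    of [t] can be written as [phi \o similarity_var a]. *)
Lemma similarity_varK a t : 0 < a < 1 -> 0 <= t ->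
  (similarity_var a t * Gamma (1 + a)) `^ a^-1 = t.
Proof.
move=> a01 t0; have [_ G0 _] := beta_Gamma a01; have /andP[a0 _] := a01.
by rewrite divfK ?gt_eqF// -powRrM mulfV ?gt_eqF// powRr1.
Qed.

Section similarity_form_facts.
Variables (a b m n : R) (u : R -> R -> R) (phi : R -> R).
Hypotheses (b01 : 0 < b < 1) (m0 : m != 0) (n0 : n != 0).
Hypothesis sim : similarity_form a b m n u phi.

Let GD : Gamma (1 + b) != 0.
Proof. by have [_ G0 _] := beta_Gamma b01; rewrite gt_eqF. Qed.

Lemma similarity_formE x t : 0 <= x -> 0 <= t ->
  u x t = m / n * (x `^ b / Gamma (1 + b) - phi (similarity_var a t)).
Proof. by move=> x0 t0; rewrite (sim x0 t0); field; rewrite m0 n0 GD. Qed.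

Lemma similarity_form_space t y : 0 <= t -> 0 <= y ->
  jumarie_derivable b (u ^~ t) y /\ jumarie b (u ^~ t) y = m / n.
Proof.
move=> t0 y0; have [dp jp] := jumarie_powR b01 y0.
have [|d ->] := @jumarie_lincomb _ b (u ^~ t) _ _ (m / n / Gamma (1 + b)) 0
  (- (m / n * phi (similarity_var a t))) y y0 _ dp dp.
  by move=> s s0; rewrite similarity_formE//; ring.
by split=> //; rewrite jp mul0r addr0 divfK.
Qed.

Lemma similarity_form_space2 t y : 0 <= t -> 0 <= y ->
  jumarie_derivable b (jumarie b (u ^~ t)) y /\ jumarie b (jumarie b (u ^~ t)) y = 0.
Proof.
move=> t0 y0; apply: (@jumarie_cst _ b _ (m / n)) => // s s0.
exact: (similarity_form_space t0 s0).2.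
Qed.

Lemma similarity_form_time x t : 0 <= x -> 0 <= t ->
  jumarie_derivable a (phi \o similarity_var a) t ->
  jumarie_derivable a (u x) t /\
  jumarie a (u x) t = - (m / n) * jumarie a (phi \o similarity_var a) t.
Proof.
move=> x0 t0 dphi.
have [|d ->] := @jumarie_lincomb _ a (u x) _ _ (- (m / n)) 0
  (m / n * (x `^ b / Gamma (1 + b))) t t0 _ dphi dphi.
  by move=> s s0; rewrite similarity_formE//=; ring.
by split=> //; rewrite mul0r addr0.
Qed.

Lemma similarity_form_timeV x t : 0 <= x -> 0 <= t ->
  jumarie_derivable a (u x) t ->
  jumarie_derivable a (phi \o similarity_var a) t.
Proof.
move=> x0 t0 du.
have [] // := @jumarie_lincomb _ a (phi \o similarity_var a) _ _ (- (n / m)) 0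
  (x `^ b / Gamma (1 + b)) t t0 _ du du.
by move=> s s0; rewrite /= (sim x0 s0); ring.
Qed.

End similarity_form_facts.

(** With [D_x^b u = m/n] and [D_x^b (D_x^b u) = 0] the equation for [u] is
    [- (m/n)] times the equation for [phi].  From Burgers to the reduced
    equation any fixed [x > 0] serves; [x = 1] is taken. *)
Lemma burgers_reduction a b m n f g G u phi : 0 < b < 1 -> m != 0 -> n != 0 ->
  (forall t, 0 < t -> jumarie a G t = g t) ->
  similarity_form a b m n u phi ->
  burgers_solution a b f g u <-> reduced_solution a m n G phi.
Proof.
move=> b01 m0 n0 hG sim; split=> [sol t t0|red x t x0 t0].
- have [du _ _ eq] := sol 1 t ltr01 t0; have t0' := ltW t0.
  have dphi := similarity_form_timeV sim ler01 t0' du.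
  split=> //; move: eq.
  rewrite (similarity_form_space2 b01 m0 n0 sim t0' ler01).2.
  rewrite (similarity_form_space b01 m0 n0 sim t0' ler01).2.
  rewrite (similarity_form_time b01 m0 n0 sim ler01 t0' dphi).2 hG// => eq.
  have mn0 : m / n != 0 by rewrite mulf_neq0// invr_eq0.
  apply: (mulfI mn0); rewrite mulr0 mulrDr -[X in X + _]opprK -mulNr eq.
  by ring.
- have [dphi eq] := red t t0; have [x0' t0'] := (ltW x0, ltW t0).
  have [du Eu] := similarity_form_time b01 m0 n0 sim x0' t0' dphi.
  have [d2 E2] := similarity_form_space2 b01 m0 n0 sim t0' x0'.
  split=> //.
    by move=> y y0; exact: (similarity_form_space b01 m0 n0 sim t0' y0).1.
  rewrite Eu E2 (similarity_form_space b01 m0 n0 sim t0' x0').2 mulr0 add0r -hG//.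
  by move/eqP: eq; rewrite addr_eq0 => /eqP ->; ring.
Qed.

End burgers_lemmas.

Theorem theorem4p3 (R : realType) (alpha beta m n : R) (f g G : R -> R)
  (halpha : 0 < alpha < 1) (hbeta : 0 < beta < 1)
  (hm : m != 0) (hn : n != 0)
  (hG : forall t, 0 < t ->
     jumarie_derivable alpha G t /\ jumarie alpha G t = g t) :
  [/\ (forall (u : R -> R -> R) (phi : R -> R),
         similarity_form alpha beta m n u phi ->
         (burgers_solution alpha beta f g u <->
          reduced_solution alpha m n G phi)),
      (forall k4 : R,
         burgers_solution alpha beta f g (general_solution beta m n G k4) /\
         exists phi : R -> R,
           similarity_form alpha beta m n (general_solution beta m n G k4) phi
           /\ reduced_solution alpha m n G phi)
    & (forall (u : R -> R -> R) (phi : R -> R),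
         {within `[0, +oo[, continuous G} ->
         {within `[0, +oo[, continuous phi} ->
         similarity_form alpha beta m n u phi ->
         reduced_solution alpha m n G phi ->
         exists k4 : R, forall x t, 0 <= x -> 0 <= t ->
           u x t = general_solution beta m n G k4 x t)].
Proof.
have hG2 t : 0 < t -> jumarie alpha G t = g t by move=> /hG[].
split.
- by move=> u phi; exact: burgers_reduction.
- move=> k4.
  (* The function of the similarity variable is [t |-> k4 - m/n * G t] read
     through the inverse of [similarity_var]. *)
  pose phi s := k4 - m / n * G ((s * Gamma (1 + alpha)) `^ alpha^-1).
  have phiE t : 0 <= t -> phi (similarity_var alpha t) = k4 - m / n * G t.
    by move=> t0; rewrite /phi similarity_varK.
  have sim : similarity_form alpha beta m n (general_solution beta m n G k4) phi.
    move=> x t x0 t0; rewrite phiE// /general_solution.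
    have [_ GD _] := beta_Gamma hbeta.
    by field; rewrite hm hn gt_eqF.
  have red : reduced_solution alpha m n G phi.
    move=> t t0; have [dG _] := hG t t0.
    have [|d ->] := @jumarie_lincomb _ alpha (phi \o similarity_var alpha) _ _
      (- (m / n)) 0 k4 t (ltW t0) _ dG dG.
      by move=> s s0; rewrite /= phiE//; ring.
    by split=> //; ring.
  split; first exact/(burgers_reduction _ hbeta hm hn hG2 sim).
  by exists phi.
- move=> u phi cG cphi sim red.
  have /andP[a0 _] := halpha.
  pose H s := phi (similarity_var alpha s) + m / n * G s.
  have cH : {within `[0, +oo[, continuous H}.
    have cps : {within `[0, +oo[, continuous (phi \o similarity_var alpha)}.
      apply: within_continuous_comp_sub (similarity_var_continuous a0) cphi.
      by move=> x _; rewrite /= in_itv/= andbT similarity_var_ge0.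
    move=> x; apply: (continuousD (cps x)).
    by apply: continuousM; [exact: cst_continuous|exact: cG].
  have dH t : 0 < t -> jumarie_derivable alpha H t /\ jumarie alpha H t = 0.
    move=> t0; have [dphi eq] := red t t0; have [dG _] := hG t t0.
    have [|d ->] := @jumarie_lincomb _ alpha H _ _ 1 (m / n) 0 t (ltW t0) _ dphi dG.
      by move=> s _; rewrite /H mul1r addr0.
    by rewrite mul1r.
  exists (H 0) => x t x0 t0.
  rewrite (similarity_formE hbeta hm hn sim)// /general_solution.
  rewrite -(jumarie_eq0_cst halpha cH dH t0) /H.
  by ring.
Qed.
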